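(* Let $X$ be a nominal random variable with values in $\Omega'=\{\omega'_1,\dots,\omega'_a\}$, $a\ge 3$, and let $Y$ be a non-deterministic real-valued random variable on the same probability space (case 1: only $X$ is nominal). Let $\gamma^*(X,Y)=\max_{s_a\in S_a}\gamma(X^{s_a},Y)$. Then $\gamma^*$ satisfies the following axioms: (A) Existence: $\gamma^*(X,Y)$ exists for every such pair $(X,Y)$. (B) Normalization: $0\le\gamma^*(X,Y)\le 1$. (D) Attainability: $\gamma^*(X,Y)=1$ if and only if $X$ and $Y$ are perfectly dependent. (E) Absolute invariance to strictly monotonic transformations: $\gamma^*(X,g(Y))=\gamma^*(X,Y)$ for every $g:\mathbb{R}\to\mathbb{R}$ that is strictly monotonic (increasing or decreasing) on the range of $Y$. (F) Symmetry: $\gamma^*(X,Y)=\gamma^*(Y,X)$. It does not satisfy axiom (C) (''$\gamma^*(X,Y)=0$ if and only if $X$ and $Y$ are independent''); more precisely, $\gamma^*(X,Y)=0$ does not imply that $X$ and $Y$ are independent, i.e. there exist such $X,Y$ that are not independent but satisfy $\gamma^*(X,Y)=0$.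
   Context: A nominal random variable $X$ takes values in a finite set $\Omega'=\{\omega'_1,\dots,\omega'_a\}$ with $a\ge3$ elements (listed in an arbitrary but fixed way, no natural order), each having positive probability. $S_a$ is the set of permutations of $\{1,\dots,a\}$. For $s_a\in S_a$, $X^{s_a}$ is the real-valued random variable equal to $s_a(i)$ when $X=\omega'_i$. Goodman–Kruskal's gamma of real-valued random variables $V,W$ is $$\gamma(V,W)=\frac{\mathbb{P}((V-\tilde V)(W-\tilde W)>0)-\mathbb{P}((V-\tilde V)(W-\tilde W)<0)}{\mathbb{P}((V-\tilde V)(W-\tilde W)>0)+\mathbb{P}((V-\tilde V)(W-\tilde W)<0)},$$ where $(\tilde V,\tilde W)$ is an independent copy of $(V,W)$. $X$ and $Y$ are perfectly dependent if there exists $s_a\in S_a$ such that the joint CDF $F_{X^{s_a},Y}$ equals either the Fréchet–Hoeffding upper bound $\min\{F_{X^{s_a}}(x),F_Y(y)\}$ or the Fréchet–Hoeffding lower bound $\max\{0,F_{X^{s_a}}(x)+F_Y(y)-1\}$. In $\gamma^*(Y,X)$ the maximum is likewise taken over the numberings of the nominal variable: $\gamma^*(Y,X)=\max_{s_a\in S_a}\gamma(Y,X^{s_a})$. *)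

(* Defs.v *)
From HB Require Import structures.
From mathcomp Require Import all_boot all_order all_algebra all_fingroup.
From mathcomp Require Import all_classical all_reals all_analysis.

Set Implicit Arguments.
Unset Strict Implicit.
Unset Printing Implicit Defensive.

Import Order.TTheory GRing.Theory Num.Theory.
Import numFieldNormedType.Exports.

Local Open Scope classical_set_scope.
Local Open Scope ring_scope.

Section gamma.
Context (d : measure_display) (T : measurableType d) (R : realType).
Variable P : probability T R.

(* The independent copy of (V, W) is realised canonically: on the product
   space (T * T, P \x P), (V, W) is read off the first coordinate and its copy
   off the second one. *)
Definition concordance (V W : T -> R) : R :=
  fine ((P \x P)%E [set t | 0 < (V t.1 - V t.2) * (W t.1 - W t.2)]).

Definition discordance (V W : T -> R) : R :=
  fine ((P \x P)%E [set t | (V t.1 - V t.2) * (W t.1 - W t.2) < 0]).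

(* Division is total in this library ([x / 0 = 0]), hence well-definedness of
   the quotient [gamma] is a separate predicate. *)
Definition gamma_exists (V W : T -> R) : Prop :=
  concordance V W + discordance V W != 0.

Definition gamma (V W : T -> R) : R :=
  (concordance V W - discordance V W) / (concordance V W + discordance V W).

Definition cdf1 (V : T -> R) (x : R) : R := fine (P [set t | V t <= x]).

Definition cdf2 (V W : T -> R) (x y : R) : R :=
  fine (P [set t | V t <= x /\ W t <= y]).

Definition nondeterministic (Y : T -> R) : Prop :=
  ~ exists c : R, P [set t | Y t = c] = 1%E.

Section nominal.
Context (Omega' : finType) (a : nat).
(* [omega'] lists the values of the nominal variable. *)
Variable omega' : 'I_a -> Omega'.

(* A finite set carries its discrete sigma-algebra. *)
Definition nominal (X : T -> Omega') : Prop :=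
  (forall A : set Omega', measurable (X @^-1` A)) /\
  (forall w : Omega', (0 < P (X @^-1` [set w]))%E).

(* X^s; the shift by one is because ['I_a] starts at 0 while the numbers given
   to the categories are 1, ..., a. For injective [omega'] the sum has exactly
   one term when [X t] is listed. *)
Definition numbering (s : 'S_a) (X : T -> Omega') : T -> R :=
  fun t => \sum_(i < a | X t == omega' i) (s i).+1%:R.

(* Starting the iterated maximum at the identity numbering makes it the maximum
   of the family itself, without any additional default value. *)
Definition gamma_star (X : T -> Omega') (Y : T -> R) : R :=
  \big[Num.max/gamma (numbering 1%g X) Y]_(s : 'S_a) gamma (numbering s X) Y.

Definition gamma_star_sym (Y : T -> R) (X : T -> Omega') : R :=
  \big[Num.max/gamma Y (numbering 1%g X)]_(s : 'S_a) gamma Y (numbering s X).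

Definition gamma_star_exists (X : T -> Omega') (Y : T -> R) : Prop :=
  (forall s : 'S_a, gamma_exists (numbering s X) Y) /\
  (exists s0 : 'S_a, gamma_star X Y = gamma (numbering s0 X) Y /\
     forall s : 'S_a, gamma (numbering s X) Y <= gamma (numbering s0 X) Y).

Definition perfectly_dependent (X : T -> Omega') (Y : T -> R) : Prop :=
  exists s : 'S_a,
    (forall x y : R, cdf2 (numbering s X) Y x y =
       Num.min (cdf1 (numbering s X) x) (cdf1 Y y)) \/
    (forall x y : R, cdf2 (numbering s X) Y x y =
       Num.max 0 (cdf1 (numbering s X) x + cdf1 Y y - 1)).

Definition independent (X : T -> Omega') (Y : T -> R) : Prop :=
  forall (A : set Omega') (B : set R), measurable B ->
    P (X @^-1` A `&` Y @^-1` B) = (P (X @^-1` A) * P (Y @^-1` B))%E.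

End nominal.
End gamma.

Definition strictly_monotonic_on (R : realType) (A : set R) (g : R -> R) : Prop :=
  {in A &, {homo g : x y / x < y}} \/ {in A &, {homo g : x y /~ x < y}}.

(* Main.v *)
Require Import Defs.
From HB Require Import structures.
From mathcomp Require Import all_boot all_order all_algebra all_fingroup.
From mathcomp Require Import all_classical all_reals all_analysis.
From mathcomp Require Import measurable_realfun ring lra.

(** For a threshold pair (x, y), the quadrants p, q, r, s of the law of (V, W)
    have independent-copy products ps and qr, which are masses of rectangles of
    concordant, resp. discordant, pairs. Letting x and y run through the
    rationals, these rectangles and their mirror images exhaust all concordant,
    resp. discordant, pairs; so there are almost surely no discordant pairs iff
    qr = 0 for all (x, y), which is the upper Frechet-Hoeffding bound, and no
    concordant ones iff ps = 0 for all (x, y), the lower bound. If all four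
    products ps and qr vanish, one of the two marginal CDFs is 0 or 1 at the
    threshold, so the denominator of gamma is positive for non-deterministic
    variables. Reversing the numbering of the categories changes the sign of
    gamma, which yields nonnegativity, the reduction of the lower bound to the
    upper one, and invariance under decreasing transformations.

    For the failure of (C), let Y vanish on one category and be a fair sign on
    each of the others: gamma is then zero for every numbering, because Y and -Y
    have the same conditional laws given X. *)

Local Open Scope classical_set_scope.
Local Open Scope ring_scope.

Section development.
Set Implicit Arguments.
Unset Strict Implicit.
Unset Printing Implicit Defensive.
Import Order.TTheory GRing.Theory Num.Theory.

(** * Countable null covers and signs of increment products *)

Lemma negligible_bigcup_countType d (T : measurableType d) (R : realType)
    (mu : {measure set T -> \bar R}) (U : countType) (F : U -> set T) :
  (forall u, mu.-negligible (F u)) -> mu.-negligible (\bigcup_u F u).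
Proof.
move=> F0.
have : mu.-negligible
    (\bigcup_n (if unpickle n is Some u then F u else set0)).
  apply: negligible_bigcup => n; case: unpickle => [u|]; first exact: F0.
  exact: negligible_set0.
by apply: negligibleS => t [u _ Fu]; exists (pickle u) => //; rewrite pickleK.
Qed.

Lemma mulBB_gt0 (R : realDomainType) (v1 v2 w1 w2 : R) :
  0 < (v1 - v2) * (w1 - w2) <-> (v1 < v2 /\ w1 < w2) \/ (v2 < v1 /\ w2 < w1).
Proof.
have [v12|v12|->] := ltgtP v1 v2; last by rewrite subrr mul0r ltxx; split; lra.
- by rewrite nmulr_rgt0 ?subr_lt0//; split; lra.
- by rewrite pmulr_rgt0 ?subr_gt0//; split; lra.
Qed.

Lemma mulBB_lt0 (R : realDomainType) (v1 v2 w1 w2 : R) :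
  (v1 - v2) * (w1 - w2) < 0 <-> (v1 < v2 /\ w2 < w1) \/ (v2 < v1 /\ w1 < w2).
Proof. by rewrite -oppr_gt0 -mulrN opprB mulBB_gt0. Qed.

(** The weak-strict form matches the split of the line into [V t <= x] and [x < V t]. *)
Lemma rat_between (R : realType) (u v : R) : u < v ->
  exists q : rat, u <= ratr q /\ ratr q < v.
Proof.
move=> /rat_in_itvoo[q]; rewrite in_itv /= => /andP[uq qv].
by exists q; split => //; exact: ltW.
Qed.

(** * Concordance and discordance through quadrants of the joint law *)

Section pair.
Context d (T : measurableType d) (R : realType) (P : probability T R).
Implicit Types (A B : set T) (V W : T -> R).

Lemma fine_probability_ge0 A : 0 <= fine (P A).
Proof. exact/fine_ge0/measure_ge0. Qed.

Lemma fine_probability_eq0 A : measurable A -> (fine (P A) == 0) = (P A == 0)%E.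
Proof. by move=> mA; rewrite fine_eq0 // fin_num_measure. Qed.

Lemma fine_probability_splitI A B : measurable A -> measurable B ->
  fine (P A) = fine (P (A `&` B)) + fine (P (A `&` ~` B)).
Proof.
move=> mA mB; have mC := measurableC mB.
rewrite -fineD; [|exact/fin_num_measure/measurableI..].
rewrite -measureU; [|exact: measurableI..|]; last first.
  by rewrite setIACA setICr setI0.
by rewrite -setIUr setUv setIT.
Qed.

(** A rectangle has mass [P A * P B], so a null [D] forces a null factor at every threshold.
    Conversely, the rational rectangles are countably many null sets covering [D]; both orders of
    the factors occur because either copy may carry the smaller value. *)
Lemma null_rectangle_cover (D : set (T * T)) (A B : R -> R -> set T) :
  measurable D ->
  (forall x y, measurable (A x y)) -> (forall x y, measurable (B x y)) ->
  (forall x y, A x y `*` B x y `<=` D) ->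
  (forall t, D t -> exists x y : rat,
     (A (ratr x) (ratr y) `*` B (ratr x) (ratr y)) t \/
     (B (ratr x) (ratr y) `*` A (ratr x) (ratr y)) t) ->
  fine ((P \x P)%E D) = 0 <->
  forall x y, fine (P (A x y)) = 0 \/ fine (P (B x y)) = 0.
Proof.
move=> mD mA mB ABD Dcover; split=> [D0 x y|AB0].
  have : ((P \x P) (A x y `*` B x y) <= (P \x P) D)%E.
    by rewrite le_measure ?inE//; exact: measurableX.
  (* [fine] also sends infinite values to 0, hence the appeal to finiteness. *)
  have -> : (P \x P)%E D = 0%E.
    rewrite -[LHS]fineK ?D0 //.
    exact: (@fin_num_measure _ _ _ ((P \x P)%E : probability _ _)).
  rewrite product_measure1E// => AB0.
  have [fA fB] : P (A x y) \is a fin_num /\ P (B x y) \is a fin_num.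
    by split; apply: fin_num_measure.
  have {AB0}: ((fine (P (A x y)))%:E * (fine (P (B x y)))%:E <= 0)%E.
    by rewrite (fineK fA) (fineK fB).
  rewrite -EFinM lee_fin => AB0.
  have /eqP : fine (P (A x y)) * fine (P (B x y)) = 0.
    by apply/eqP; rewrite eq_le AB0 mulr_ge0// fine_probability_ge0.
  by rewrite mulf_eq0 => /orP[] /eqP ?; [left|right].
have null (x y : rat) C E : (C = A /\ E = B) \/ (C = B /\ E = A) ->
    (P \x P)%E.-negligible (C (ratr x) (ratr y) `*` E (ratr x) (ratr y)).
  move=> CE; have [mC mE] : measurable (C (ratr x) (ratr y)) /\
      measurable (E (ratr x) (ratr y)) by case: CE => -[-> ->].
  have CE0 : (P (C (ratr x) (ratr y)) * P (E (ratr x) (ratr y)) = 0)%E.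
    apply/eqP; rewrite mule_eq0 -!fine_probability_eq0//.
    by case: CE => -[-> ->]; case: (AB0 (ratr x) (ratr y)) => ->; rewrite eqxx ?orbT.
  apply/negligibleP; first exact: measurableX.
  exact: etrans (product_measure1E P P mC mE) CE0.
suff /negligibleP : (P \x P)%E.-negligible D by move=> /(_ mD) ->.
have : (P \x P)%E.-negligible (\bigcup_(xy : rat * rat)
   (A (ratr xy.1) (ratr xy.2) `*` B (ratr xy.1) (ratr xy.2) `|`
    B (ratr xy.1) (ratr xy.2) `*` A (ratr xy.1) (ratr xy.2))).
  apply: negligible_bigcup_countType => xy.
  by apply: negligibleU; apply: null; [left|right].
by apply: negligibleS => t /Dcover[x [y xy]]; exists (x, y).
Qed.

Lemma measurable_le_cst V x : measurable_fun setT V ->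
  measurable [set t | V t <= x].
Proof.
move=> mV; rewrite -[X in measurable X]setTI.
suff -> : [set t | V t <= x] = V @^-1` `]-oo, x] by exact: mV.
by apply/seteqP; split => t /=; rewrite in_itv.
Qed.

Lemma setC_le_cst V x : ~` [set t | V t <= x] = [set t | x < V t].
Proof. by apply/seteqP; split => t /=; rewrite ltNge => /negP. Qed.

Lemma measurable_gt_cst V x : measurable_fun setT V ->
  measurable [set t | x < V t].
Proof. by move=> mV; rewrite -setC_le_cst; exact/measurableC/measurable_le_cst. Qed.

Section measurable_pair.
Variables V W : T -> R.
Hypotheses (mV : measurable_fun setT V) (mW : measurable_fun setT W).

Lemma measurable_increment_product :
  measurable_fun setT (fun t : T * T => (V t.1 - V t.2) * (W t.1 - W t.2)).
Proof.
apply: measurable_funM; apply: measurable_funB.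
- exact: (measurableT_comp mV measurable_fst).
- exact: (measurableT_comp mV measurable_snd).
- exact: (measurableT_comp mW measurable_fst).
- exact: (measurableT_comp mW measurable_snd).
Qed.

Lemma measurable_concordant :
  measurable [set t : T * T | 0 < (V t.1 - V t.2) * (W t.1 - W t.2)].
Proof.
rewrite -[X in measurable X]setTI.
have -> : [set t : T * T | 0 < (V t.1 - V t.2) * (W t.1 - W t.2)] =
    (fun t : T * T => (V t.1 - V t.2) * (W t.1 - W t.2)) @^-1` `]0, +oo[.
  by apply/seteqP; split => t /=; rewrite in_itv /= andbT.
exact: measurable_increment_product.
Qed.

Lemma measurable_discordant :
  measurable [set t : T * T | (V t.1 - V t.2) * (W t.1 - W t.2) < 0].
Proof.
rewrite -[X in measurable X]setTI.
have -> : [set t : T * T | (V t.1 - V t.2) * (W t.1 - W t.2) < 0] =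
    (fun t : T * T => (V t.1 - V t.2) * (W t.1 - W t.2)) @^-1` `]-oo, 0[.
  by apply/seteqP; split => t /=; rewrite in_itv.
exact: measurable_increment_product.
Qed.

Lemma concordance_eq0 : concordance P V W = 0 <-> forall x y,
  fine (P [set t | V t <= x /\ W t <= y]) = 0 \/
  fine (P [set t | x < V t /\ y < W t]) = 0.
Proof.
apply: null_rectangle_cover.
- exact: measurable_concordant.
- by move=> x y; apply: measurableI; exact: measurable_le_cst.
- by move=> x y; apply: measurableI; exact: measurable_gt_cst.
- move=> x y t [/= [? ?] [? ?]]; apply/mulBB_gt0; left; split; lra.
- by move=> t /mulBB_gt0[] [/rat_between[x [? ?]] /rat_between[y [? ?]]];
    exists x, y; [left|right].
Qed.

Lemma discordance_eq0 : discordance P V W = 0 <-> forall x y,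
  fine (P [set t | V t <= x /\ y < W t]) = 0 \/
  fine (P [set t | x < V t /\ W t <= y]) = 0.
Proof.
apply: null_rectangle_cover.
- exact: measurable_discordant.
- move=> x y; apply: measurableI; first exact: measurable_le_cst.
  exact: measurable_gt_cst.
- move=> x y; apply: measurableI; first exact: measurable_gt_cst.
  exact: measurable_le_cst.
- move=> x y t [/= [? ?] [? ?]]; apply/mulBB_lt0; left; split; lra.
- by move=> t /mulBB_lt0[] [/rat_between[x [? ?]] /rat_between[y [? ?]]];
    exists x, y; [left|right].
Qed.

(** This turns statements about CDFs into linear arithmetic in four nonnegative masses. *)
Lemma cdf_quadrants x y :
  let p := fine (P [set t | V t <= x /\ W t <= y]) in
  let q := fine (P [set t | V t <= x /\ y < W t]) in
  let r := fine (P [set t | x < V t /\ W t <= y]) in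
  let s := fine (P [set t | x < V t /\ y < W t]) in
  [/\ cdf1 P V x = p + q, cdf1 P W y = p + r & p + q + r + s = 1].
Proof.
have mVx := measurable_le_cst x mV; have mWy := measurable_le_cst y mW.
have Vx : cdf1 P V x = fine (P [set t | V t <= x /\ W t <= y]) +
    fine (P [set t | V t <= x /\ y < W t]).
  by rewrite /cdf1 (fine_probability_splitI mVx mWy) setC_le_cst.
split=> //.
  rewrite /cdf1 (fine_probability_splitI mWy mVx) setC_le_cst.
  by rewrite setIC [X in _ + fine (P X)]setIC.
have -> : 1 = fine (P setT) by rewrite probability_setT.
rewrite (fine_probability_splitI measurableT mVx) !setTI setC_le_cst.
rewrite -[fine (P [set t | V t <= x])]/(cdf1 P V x) Vx -!addrA; congr (_ + (_ + _)).
rewrite [RHS](fine_probability_splitI (measurable_gt_cst x mV) mWy).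
by rewrite setC_le_cst.
Qed.

(** In quadrant masses the bound reads [p = min (p + q) (p + r)], that is, [q = 0] or [r = 0]. *)
Lemma cdf2_upperP :
  (forall x y, cdf2 P V W x y = Num.min (cdf1 P V x) (cdf1 P W y)) <->
  discordance P V W = 0.
Proof.
rewrite discordance_eq0; split=> H x y; move: (H x y);
  have [-> -> _] := cdf_quadrants x y; rewrite /cdf2;
  move: (fine_probability_ge0 [set t | V t <= x /\ y < W t])
        (fine_probability_ge0 [set t | x < V t /\ W t <= y]).
  by rewrite minElt; case: ifP => _ q0 r0 E; [left|right]; lra.
by move=> q0 r0 [] E; rewrite E addr0; [rewrite min_l|rewrite min_r]; lra.
Qed.

(** Since the masses sum to 1, the two CDFs minus 1 give [p - s]; and [p = max 0 (p - s)] means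
    [p = 0] or [s = 0]. *)
Lemma cdf2_lowerP :
  (forall x y, cdf2 P V W x y = Num.max 0 (cdf1 P V x + cdf1 P W y - 1)) <->
  concordance P V W = 0.
Proof.
rewrite concordance_eq0; split=> H x y; move: (H x y);
  have [-> -> E] := cdf_quadrants x y; rewrite /cdf2;
  move: (fine_probability_ge0 [set t | V t <= x /\ W t <= y])
        (fine_probability_ge0 [set t | x < V t /\ y < W t]).
  by rewrite maxElt; case: ifP => _ q0 r0 F; [right|left]; lra.
by move=> q0 r0 [] F; [rewrite max_l|rewrite max_r]; lra.
Qed.

End measurable_pair.

(* If every [cdf1 P W q] is 0 or 1, then almost every value of [W] lies on the
   same side of each rational, so [W] is a.s. constant. *)
Lemma nondeterministic_split W : measurable_fun setT W -> nondeterministic P W ->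
  exists y, 0 < cdf1 P W y < 1.
Proof.
move=> mW; apply: contra_notP => /forallNP W01.
(* [N q] is whichever half-line event at [q] is null; outside their union, no rational separates two
   values of [W]. *)
pose N (q : rat) := if cdf1 P W (ratr q) == 0 then [set t | W t <= ratr q]
  else [set t | ratr q < W t].
have mN q : measurable (N q).
  rewrite /N; case: ifP => _; first exact: measurable_le_cst.
  exact: measurable_gt_cst.
have N0 q : P.-negligible (N q).
  apply/negligibleP => //; apply/eqP; rewrite -fine_probability_eq0// /N.
  case: ifPn => // F0.
  have F1 : cdf1 P W (ratr q) = 1.
    apply/eqP; rewrite eq_le; apply/andP; split.
      rewrite -lee_fin fineK ?fin_num_measure//; last exact: measurable_le_cst.
      by apply: probability_le1; exact: measurable_le_cst.
    rewrite leNgt; apply/negP => F1; apply: (W01 (ratr q)).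
    by rewrite lt0r F0 F1 fine_probability_ge0.
  have := fine_probability_splitI measurableT (measurable_le_cst (ratr q) mW).
  rewrite !setTI setC_le_cst probability_setT [fine (P [set t | W t <= _])]F1 /=.
  lra.
have mU : measurable (\bigcup_q N q) by exact: bigcupT_measurable_rat.
have PU : P (\bigcup_q N q) = 0%E.
  by apply/negligibleP => //; exact: negligible_bigcup_countType.
have PC : P (~` \bigcup_q N q) = 1%E by rewrite probability_setC// PU sube0.
have [t0 Nt0] : (~` \bigcup_q N q) !=set0.
  apply/set0P/eqP => E; move: PC; rewrite E measure0 => /eqP.
  by rewrite eqe eq_sym oner_eq0.
have sep u v : (~` \bigcup_q N q) u -> (~` \bigcup_q N q) v -> ~ W u < W v.
  move=> Nu Nv /rat_between[q [uq qv]].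
  case: (boolP (cdf1 P W (ratr q) == 0)) => F0.
    by apply: Nu; exists q => //; rewrite /N F0.
  by apply: Nv; exists q => //; rewrite /N (negbTE F0).
exists (W t0); apply/eqP; rewrite eq_le probability_le1/=; last first.
  by rewrite -[X in measurable X]setTI; exact: (mW _ _ (measurable_set1 _)).
rewrite -PC le_measure ?inE//; first exact: measurableC.
  by rewrite -[X in measurable X]setTI; exact: (mW _ _ (measurable_set1 _)).
move=> t Nt /=; apply/eqP; rewrite eq_le !leNgt.
by apply/andP; split; apply/negP; exact: sep.
Qed.

Lemma nondeterministic_gamma_exists V W :
  measurable_fun setT V -> measurable_fun setT W ->
  nondeterministic P V -> nondeterministic P W -> gamma_exists P V W.
Proof.
move=> mV mW /(nondeterministic_split mV)[x Vx] /(nondeterministic_split mW)[y Wy].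
have c0 : 0 <= concordance P V W by exact/fine_ge0/measure_ge0.
have d0 : 0 <= discordance P V W by exact/fine_ge0/measure_ge0.
rewrite /gamma_exists paddr_eq0//; apply/negP => /andP[/eqP + /eqP].
move=> /(concordance_eq0 mV mW)/(_ x y) + /(discordance_eq0 mV mW)/(_ x y).
(* Choosing one of [p], [s] and one of [q], [r] to vanish always empties a row or a column of the
   quadrant table, against [0 < cdf1 < 1]. *)
move: Vx Wy; have [-> -> E] := cdf_quadrants mV mW x y; lra.
Qed.

(** * Range, symmetry and sign changes of gamma *)

Lemma gamma_itv V W : -1 <= gamma P V W <= 1.
Proof.
have c0 : 0 <= concordance P V W by exact/fine_ge0/measure_ge0.
have d0 : 0 <= discordance P V W by exact/fine_ge0/measure_ge0.
(* With a zero denominator the quotient is 0 by convention, still inside the interval. *)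
rewrite /gamma; have [->|n0] := eqVneq (concordance P V W + discordance P V W) 0.
  by rewrite invr0 mulr0; lra.
have s0 : 0 < concordance P V W + discordance P V W by rewrite lt0r n0 addr_ge0.
by rewrite ler_pdivlMr// ler_pdivrMr//; lra.
Qed.

Lemma gamma_eq1 V W : gamma_exists P V W ->
  gamma P V W = 1 <-> discordance P V W = 0.
Proof.
rewrite /gamma_exists /gamma => n0; split => [E|d0].
  by have := divfK n0 (concordance P V W - discordance P V W); rewrite E mul1r; lra.
by rewrite d0 subr0 addr0 divff//; move: n0; rewrite d0 addr0.
Qed.

Lemma concordance_sym V W : concordance P V W = concordance P W V.
Proof. by congr (fine (_ _)); apply/seteqP; split => t /=; rewrite mulrC. Qed.

Lemma discordance_sym V W : discordance P V W = discordance P W V.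
Proof. by congr (fine (_ _)); apply/seteqP; split => t /=; rewrite mulrC. Qed.

Lemma gamma_sym V W : gamma P V W = gamma P W V.
Proof. by rewrite /gamma concordance_sym discordance_sym. Qed.

(** Only increments of [V'] are constrained, so that reflections such as [a + 1 - V] are covered as
    well as [- V]. *)
Lemma discordance_flip V V' W :
  (forall t u, V' t - V' u = V u - V t) ->
  discordance P V' W = concordance P V W.
Proof.
move=> E; congr (fine (_ _)); apply/seteqP; split => t /=;
  by rewrite E -(opprB (V t.1)) mulNr oppr_lt0.
Qed.

Lemma concordance_flip V V' W :
  (forall t u, V' t - V' u = V u - V t) ->
  concordance P V' W = discordance P V W.
Proof. by move=> E; rewrite (@discordance_flip V' V)// => t u; rewrite E opprB. Qed.

Lemma gamma_flip V V' W :
  (forall t u, V' t - V' u = V u - V t) -> gamma P V' W = - gamma P V W.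
Proof.
move=> E; rewrite /gamma (concordance_flip W E) (discordance_flip W E).
by rewrite [X in _ / X]addrC -mulNr opprB.
Qed.

(** Concordance and discordance depend on [W] only through order comparisons of its values, which
    [g] preserves. *)
Lemma gamma_increasing V W g : {in range W &, {homo g : x y / x < y}} ->
  gamma P V (g \o W) = gamma P V W.
Proof.
move=> gh; have rW t : W t \in range W by apply/mem_set; exists t.
have gE t u : (g (W t) < g (W u)) = (W t < W u).
  have [h|h|->] := ltgtP (W t) (W u); last by rewrite ltxx.
    by rewrite gh.
  by apply/negbTE; rewrite -leNgt ltW// gh.
rewrite /gamma /concordance /discordance.
have -> : [set t | 0 < (V t.1 - V t.2) * ((g \o W) t.1 - (g \o W) t.2)] =
    [set t | 0 < (V t.1 - V t.2) * (W t.1 - W t.2)].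
  by apply/seteqP; split => t /= /mulBB_gt0; rewrite ?gE => ?;
    apply/mulBB_gt0; rewrite ?gE.
suff -> : [set t | (V t.1 - V t.2) * ((g \o W) t.1 - (g \o W) t.2) < 0] =
    [set t | (V t.1 - V t.2) * (W t.1 - W t.2) < 0] by [].
by apply/seteqP; split => t /= /mulBB_lt0; rewrite ?gE => ?;
    apply/mulBB_lt0; rewrite ?gE.
Qed.

Lemma gamma_decreasing V W g : {in range W &, {homo g : x y /~ x < y}} ->
  gamma P V (g \o W) = - gamma P V W.
Proof.
move=> gh; have -> : gamma P V (g \o W) = - gamma P V ((\- g) \o W).
  by rewrite gamma_sym [in RHS]gamma_sym; apply: gamma_flip => t u /=; ring.
rewrite gamma_increasing// => x y xW yW xy /=; rewrite ltrN2; exact: gh.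
Qed.

End pair.

(** * Maximizing gamma over the numberings of a nominal variable *)

Section nominal_variable.
Context d (T : measurableType d) (R : realType) (P : probability T R).
Context (a : nat) (Omega' : finType) (omega' : 'I_a -> Omega').
Hypothesis homega' : bijective omega'.
Implicit Types (X : T -> Omega') (Y : T -> R) (s : 'S_a).

(** The product acts by [s] first, so the number [k] of a category becomes [a + 1 - k]. *)
Definition reverse s : 'S_a := (s * perm (@rev_ord_inj a))%g.

Lemma numberingE : exists2 g : Omega' -> 'I_a, cancel omega' g &
  forall s X t, numbering R omega' s X t = (s (g (X t))).+1%:R :> R.
Proof.
have [g gK Kg] := homega'; exists g => // s X t.
rewrite /numbering (big_pred1 (g (X t)))// => i.
by rewrite /= -(inj_eq (can_inj gK)) Kg eq_sym.
Qed.

Lemma numbering_reverse s X (t u : T) :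
  numbering R omega' (reverse s) X t - numbering R omega' (reverse s) X u =
  numbering R omega' s X u - numbering R omega' s X t :> R.
Proof.
have [g _ E] := numberingE; rewrite !E.
have revE i : (reverse s i).+1%:R = a%:R - (s i)%:R :> R.
  by rewrite permM permE /= subnSK// natrB// ltnW.
by rewrite !revE -!natr1; ring.
Qed.

Lemma gamma_reverse s X Y :
  gamma P (numbering R omega' (reverse s) X) Y =
  - gamma P (numbering R omega' s X) Y.
Proof. by apply: gamma_flip => t u; exact: numbering_reverse. Qed.

Lemma le_gamma_star s X Y :
  gamma P (numbering R omega' s X) Y <= gamma_star P omega' X Y.
Proof.
exact: (le_bigmax _ (fun s : 'S_a => gamma P (numbering R omega' s X) Y)).
Qed.

Lemma gamma_star_le X Y m :
  (forall s, gamma P (numbering R omega' s X) Y <= m) ->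
  gamma_star P omega' X Y <= m.
Proof. by move=> le_m; apply: bigmax_le. Qed.

Lemma gamma_star_attained X Y :
  exists s, gamma_star P omega' X Y = gamma P (numbering R omega' s X) Y.
Proof.
apply: (big_ind (fun m => exists s, m = gamma P (numbering R omega' s X) Y)).
- by exists 1%g.
- by move=> _ _ [s ->] [s' ->]; rewrite maxElt; case: ifP; [exists s'|exists s].
- by move=> s _; exists s.
Qed.

(** A numbering and its reversal have opposite gammas, so one of the two is nonnegative. *)
Lemma gamma_star_itv X Y : 0 <= gamma_star P omega' X Y <= 1.
Proof.
apply/andP; split; last first.
  apply: gamma_star_le => s.
  by have /andP[] := gamma_itv P (numbering R omega' s X) Y.
by have := le_gamma_star (reverse 1%g) X Y; have := le_gamma_star 1%g X Y;
  rewrite gamma_reverse; lra.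
Qed.

Lemma gamma_star_monotonic X Y g : strictly_monotonic_on (range Y) g ->
  gamma_star P omega' X (g \o Y) = gamma_star P omega' X Y.
Proof.
case=> gh.
  by rewrite /gamma_star gamma_increasing//; apply: eq_bigr => s _;
    rewrite gamma_increasing.
(* For decreasing [g], the sign change is absorbed by reversing the numbering, in both
   directions. *)
apply/eqP; rewrite eq_le; apply/andP; split; apply: gamma_star_le => s.
  by rewrite gamma_decreasing// -gamma_reverse le_gamma_star.
rewrite -[leLHS]opprK -gamma_reverse -(gamma_decreasing P _ gh).
exact: le_gamma_star.
Qed.

Lemma gamma_star_symE X Y : gamma_star P omega' X Y = gamma_star_sym P omega' Y X.
Proof.
by rewrite /gamma_star /gamma_star_sym gamma_sym; apply: eq_bigr => s _;
  rewrite gamma_sym.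
Qed.

Section nominal.
Variable X : T -> Omega'.
Hypothesis nX : nominal P X.

Lemma measurable_numbering s :
  measurable_fun setT (numbering R omega' s X : T -> R).
Proof.
have [g _ E] := numberingE; move=> _ B _; rewrite setTI.
rewrite (_ : _ @^-1` B = X @^-1` [set w | B (s (g w)).+1%:R]); first exact: nX.1.
by apply/seteqP; split => t /=; rewrite E.
Qed.

Lemma nondeterministic_numbering s : (2 <= a)%N ->
  nondeterministic P (numbering R omega' s X).
Proof.
move=> a2 [c Vc]; have [g gK E] := numberingE.
(* Two categories carry distinct numbers, so one of them misses [c]; its positive mass contradicts
   almost sure constancy. *)
have [i ic] : exists i : 'I_a, (s i).+1%:R != c.
  pose i0 := Ordinal (ltnW a2); pose i1 := Ordinal a2.
  case: (eqVneq (s i0).+1%:R c) => [i0c|]; last by exists i0.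
  exists i1; rewrite -i0c eqr_nat eqSS; apply/negP => /eqP /val_inj /perm_inj.
  by move/(congr1 val).
have mc : measurable [set t | numbering R omega' s X t = c].
  rewrite -[X in measurable X]setTI.
  exact: (measurable_numbering s measurableT (measurable_set1 c)).
have : (P (X @^-1` [set omega' i]) <=
        P (~` [set t | numbering R omega' s X t = c]))%E.
  rewrite le_measure ?inE//; [exact: nX.1|exact: measurableC|].
  by move=> t /= Xt; rewrite E Xt gK; exact/eqP.
rewrite probability_setC// Vc subee// leNgt => /negP; apply; exact: nX.2.
Qed.

End nominal.

Lemma gamma_star_eq1 X Y : (2 <= a)%N -> nominal P X ->
  measurable_fun setT Y -> nondeterministic P Y ->
  gamma_star P omega' X Y = 1 <-> perfectly_dependent P omega' X Y.
Proof.
move=> a2 nX mY nY.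
have ex s : gamma_exists P (numbering R omega' s X) Y.
  by apply: nondeterministic_gamma_exists => //;
    [exact: measurable_numbering|exact: nondeterministic_numbering].
have mV s := measurable_numbering nX s.
split=> [|[s Vs]].
  have [s ->] := gamma_star_attained X Y => /(gamma_eq1 (ex s)) d0.
  by exists s; left; exact/cdf2_upperP.
(* Under the lower bound there is no concordance; reversing the numbering turns this into no
   discordance. *)
have [s' d0] : exists s', discordance P (numbering R omega' s' X) Y = 0.
  case: Vs => [/(cdf2_upperP P (mV s) mY)|/(cdf2_lowerP P (mV s) mY)] E.
    by exists s.
  exists (reverse s); rewrite -E; apply: discordance_flip => t u.
  exact: numbering_reverse.
apply/eqP; rewrite eq_le; have /andP[_ ->] := gamma_star_itv X Y.
by have /(gamma_eq1 (ex s')) <- := d0; exact: le_gamma_star.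
Qed.

Lemma gamma_star_existsT X Y : (2 <= a)%N -> nominal P X ->
  measurable_fun setT Y -> nondeterministic P Y ->
  gamma_star_exists P omega' X Y.
Proof.
move=> a2 nX mY nY; split=> [s|].
  by apply: nondeterministic_gamma_exists => //;
    [exact: measurable_numbering|exact: nondeterministic_numbering].
have [s E] := gamma_star_attained X Y; exists s; split=> // s'.
by rewrite -E le_gamma_star.
Qed.

End nominal_variable.

(** * Vanishing of gamma under a measure-preserving sign change *)

Section involution.
Context d (T : measurableType d) (R : realType) (P : probability T R).
Variable phi : T -> T.
Hypothesis mphi : measurable_fun setT phi.
Hypothesis Pphi : forall A, measurable A -> P (phi @^-1` A) = P A.

(** The image of [P \x P] under [phi] on both coordinates agrees with [P \x P] on rectangles, and
    these determine the product measure. *)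
Lemma product_preserving (D : set (T * T)) : measurable D ->
  (P \x P)%E [set t | D (phi t.1, phi t.2)] = (P \x P)%E D.
Proof.
move=> mD; pose phi2 (t : T * T) := (phi t.1, phi t.2).
have mphi2 : measurable_fun setT phi2.
  by apply: measurable_fun_pair;
    [exact: (measurableT_comp mphi measurable_fst)|
     exact: (measurableT_comp mphi measurable_snd)].
pose phi2' : {mfun (T * T)%type >-> (T * T)%type} :=
  HB.pack phi2 (isMeasurableFun.Build _ _ _ _ phi2 mphi2).
pose Q : probability _ R := distribution ((P \x P)%E : probability _ R) phi2'.
apply/esym; apply: (@product_measure_unique _ _ _ _ _ P P Q) => // A B mA mB.
have E : (P (phi @^-1` A) * P (phi @^-1` B) = P A * P B)%E by rewrite !Pphi.
apply: etrans E; apply: (product_measure1E P P);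
  by rewrite -[X in measurable X]setTI; exact: mphi.
Qed.

(** Applying [phi] to both copies exchanges concordant and discordant pairs without changing
    probabilities. *)
Lemma gamma_involution (V W : T -> R) :
  measurable_fun setT V -> measurable_fun setT W ->
  (forall t, V (phi t) = V t) -> (forall t, W (phi t) = - W t) ->
  gamma P V W = 0.
Proof.
move=> mV mW Vphi Wphi; rewrite /gamma.
suff -> : concordance P V W = discordance P V W by rewrite subrr mul0r.
rewrite /concordance -(product_preserving (measurable_concordant mV mW)).
congr (fine (_ _)); apply/seteqP; split => t /=;
  by rewrite !Vphi !Wphi -opprD mulrN oppr_gt0.
Qed.

End involution.

(** * A dependent pair with zero maximal gamma *)

Section twins.
Variables (R : realType) (n : nat).

Definition twin_weight : {nonneg R} := (n.+1.*2%:R^-1)%:nng.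

(* A sample point [m] encodes the category [m./2] and, by its parity, the fair
   sign. *)
Definition twins (i : nat) : {measure set nat -> \bar R} :=
  msum (fun k => dirac (i.*2 + k)%N) 2.

(** The uniform law on the naturals below [2 * (n + 1)]: two points for each of the [n + 1]
    categories. *)
Definition twin_prob : set nat -> \bar R := mscale twin_weight (msum twins n.+1).

HB.instance Definition _ := Measure.on twin_prob.

Lemma twin_probE A : twin_prob A =
  (n.+1.*2%:R^-1 * \sum_(i < n.+1) (\1_A i.*2 + \1_A i.*2.+1))%:E.
Proof.
rewrite /twin_prob /mscale /msum /= EFinM; congr (_ * _)%E.
rewrite -sumEFin; apply: eq_bigr => i _.
by rewrite /twins /= /msum big_ord_recl big_ord1 /= addn0 addn1 !diracE !indicE -EFinD.
Qed.

Lemma twin_prob_setT : twin_prob setT = 1%E.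
Proof.
rewrite twin_probE; under eq_bigr do rewrite !indicE !mem_setT.
by rewrite sumr_const card_ord /= !mulr1n mulrnDl -natrD addnn mulVf// pnatr_eq0.
Qed.

HB.instance Definition _ :=
  Measure_isProbability.Build _ _ _ twin_prob twin_prob_setT.

Lemma twin_prob_gt0 A i : (i <= n)%N -> A i.*2 -> (0 < twin_prob A)%E.
Proof.
move=> le_in Ai; rewrite twin_probE lte_fin mulr_gt0 ?invr_gt0//.
rewrite (bigD1 (Ordinal (le_in : (i < n.+1)%N)))//=.
by rewrite [\1_A i.*2]indicE (mem_set Ai) -addrA ltr_pwDl// addr_ge0// sumr_ge0.
Qed.

(** Exchanging [2i] and [2i + 1] keeps the category and flips the sign. *)
Definition swap_twins (m : nat) : nat := if odd m then m.-1 else m.+1.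

Lemma half_swap_twins m : (swap_twins m)./2 = m./2.
Proof.
rewrite /swap_twins; case: ifPn => [|/negbTE m_even]; last first.
  by rewrite /= uphalf_half m_even.
by case: m => //= m /negbTE m_even; rewrite uphalf_half m_even.
Qed.

Lemma odd_swap_twins m : odd (swap_twins m) = ~~ odd m.
Proof.
rewrite /swap_twins; case: ifPn => [|/negbTE m_even]; last by rewrite /= m_even.
by case: m => // m /= /negbTE ->.
Qed.

Lemma twin_prob_swap A : twin_prob (swap_twins @^-1` A) = twin_prob A.
Proof.
have swE m : \1_(swap_twins @^-1` A) m = \1_A (swap_twins m) :> R by rewrite !indicE.
rewrite !twin_probE; congr (_ * _)%:E; apply: eq_bigr => i _.
by rewrite !swE /swap_twins /= odd_double addrC.
Qed.

Section counterexample.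
Context (Omega' : finType) (omega' : 'I_n.+1 -> Omega').
Hypotheses (homega' : bijective omega') (n_gt0 : (0 < n)%N).

(** Beyond the support of [twin_prob], [inord] falls back to index 0; these points have mass
    zero. *)
Definition twin_X (m : nat) : Omega' := omega' (inord m./2).

Definition twin_Y (m : nat) : R :=
  if twin_X m == omega' ord0 then 0 else (-1) ^+ odd m.

Lemma measurable_twin_Y : measurable_fun setT twin_Y.
Proof. by []. Qed.

HB.instance Definition _ :=
  isMeasurableFun.Build _ _ _ _ twin_Y measurable_twin_Y.

Lemma twin_X_double i : (i <= n)%N -> twin_X i.*2 = omega' (inord i).
Proof. by rewrite /twin_X doubleK. Qed.

Lemma nominal_twin_X : nominal twin_prob twin_X.
Proof.
split=> // w; have [g gK Kg] := homega'.
apply: (@twin_prob_gt0 _ (g w)); first by rewrite -ltnS.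
by rewrite /= twin_X_double; [rewrite inord_val Kg|rewrite -ltnS].
Qed.

Lemma nondeterministic_twin_Y : nondeterministic twin_prob twin_Y.
Proof.
move=> [c Yc].
have : twin_prob (~` [set m | twin_Y m = c]) = 0%E.
  by rewrite probability_setC// Yc subee.
move=> E; have Yc_double i : (i <= n)%N -> twin_Y i.*2 = c.
  move=> le_in; apply: contrapT => Yi.
  by have := @twin_prob_gt0 (~` [set m | twin_Y m = c]) i le_in Yi; rewrite E ltxx.
(* The sample points 0 and 2, both of positive mass, give [twin_Y] the values 0 and 1. *)
have := Yc_double 1 n_gt0; rewrite -(Yc_double 0)// /twin_Y !twin_X_double//.
rewrite !(bij_eq homega') !odd_double expr0 -!val_eqE /= !inordK// eqxx /=.
by move/eqP; rewrite oner_eq0.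
Qed.

(** The category [omega' ord0] forces [twin_Y = 0]. Independence would give
    [P A = P A * P(twin_Y = 0)] for its event [A] of positive mass, making [twin_Y] almost surely
    0. *)
Lemma not_independent_twins : ~ independent twin_prob twin_X twin_Y.
Proof.
move=> indep; apply: nondeterministic_twin_Y; exists 0.
have := indep [set omega' ord0] [set 0] (measurable_set1 _).
rewrite (_ : _ `&` _ = twin_X @^-1` [set omega' ord0]); last first.
  by apply/setIidPl => m /= Xm; rewrite /twin_Y Xm eqxx.
have [_ /(_ (omega' ord0))] := nominal_twin_X.
move: (twin_X @^-1` [set omega' ord0]) => A.
have fA : twin_prob A \is a fin_num by apply: fin_num_measure.
have fB : twin_prob (twin_Y @^-1` [set 0]) \is a fin_num by apply: fin_num_measure.
move=> A0 E; have {}A0 : (0 < twin_prob A)%E := A0.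
suff : twin_prob (twin_Y @^-1` [set 0]) = 1%E by [].
have {}E : twin_prob A = (twin_prob A * twin_prob (twin_Y @^-1` [set 0%R]))%E := E.
move: A0 E; rewrite -(fineK fA) -(fineK fB) -EFinM lte_fin => A0 [] E; congr (_%:E).
by apply: (mulfI (lt0r_neq0 A0)); rewrite mulr1 -E.
Qed.

Lemma gamma_star_twins : gamma_star twin_prob omega' twin_X twin_Y = 0.
Proof.
have gamma0 s : gamma twin_prob (numbering R omega' s twin_X) twin_Y = 0.
  apply: (@gamma_involution _ _ _ _ swap_twins) => //.
  - by move=> A _; exact: twin_prob_swap.
  - by move=> m; rewrite /numbering /twin_X half_swap_twins.
  - move=> m; rewrite /twin_Y /twin_X half_swap_twins odd_swap_twins.
    by case: ifP => _; rewrite ?oppr0//; case: odd; rewrite ?expr1 ?expr0 ?opprK.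
apply: (big_ind (fun m => m = 0)) => [|_ _ -> ->|s _]; rewrite ?maxxx//.
Qed.

End counterexample.
End twins.
End development.

Theorem proposition5p2 (R : realType) (a : nat) (ha : (3 <= a)%N)
    (Omega' : finType) (omega' : 'I_a -> Omega') (homega' : bijective omega') :
  (forall (d : measure_display) (T : measurableType d) (P : probability T R)
      (X : T -> Omega') (Y : {RV P >-> R}),
    nominal P X -> nondeterministic P Y ->
    (* (A) existence *)
    gamma_star_exists P omega' X Y /\
    (* (B) normalization *)
    0 <= gamma_star P omega' X Y <= 1 /\
    (* (D) attainability *)
    (gamma_star P omega' X Y = 1 <-> perfectly_dependent P omega' X Y) /\
    (* (E) invariance under strictly monotonic transformations *)
    (forall g : R -> R, strictly_monotonic_on (range Y) g ->
       gamma_star P omega' X (g \o Y) = gamma_star P omega' X Y) /\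
    (* (F) symmetry *)
    gamma_star P omega' X Y = gamma_star_sym P omega' Y X) /\
  (* failure of (C) *)
  (exists (d : measure_display) (T : measurableType d) (P : probability T R)
      (X : T -> Omega') (Y : {RV P >-> R}),
    [/\ nominal P X, nondeterministic P Y,
        gamma_star P omega' X Y = 0 & ~ independent P X Y]).
Proof.
have a2 := ltnW ha; split.
  move=> d T P X Y nX nY; have mY : measurable_fun setT Y by [].
  split; first exact: gamma_star_existsT.
  split; first exact: gamma_star_itv.
  split; first exact: gamma_star_eq1.
  split; last exact: gamma_star_symE.
  by move=> g; exact: gamma_star_monotonic.
case: a ha omega' homega' {a2} => // n n2 omega' homega'.
have n0 : (0 < n)%N by apply: ltnW.
exists default_measure_display, nat, (twin_prob R n), (twin_X omega'),
  (twin_Y R omega').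
split.
- exact: nominal_twin_X.
- exact: nondeterministic_twin_Y.
- exact: gamma_star_twins.
- exact: not_independent_twins.
Qed.
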